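(* There is an absolute constant $C$ such that the following holds. Let $T$ be a finite set of primes, and let either $Y=U_T$ and $H=H(T)$, or $Y=W_T$ and $H=H'(T)$. Let $Z\sim\mathrm{Pois}(H)$. Then for every integer $k\ge 0$, \[ |\mathbb P(Y=k)-\mathbb P(Z=k)|\le\begin{cases} C\,H''(T)\,\dfrac{H^k}{k!}\mathrm{e}^{-H}\Big(\dfrac1{k+1}+\Big(\dfrac{k-H}{H}\Big)^2\Big) & \text{if } 0\le k\le 1.9H,\\[2mm] C\,H''(T)\,\dfrac{\mathrm{e}^{0.9H}}{(1.9)^k} & \text{if } k>1.9H.\end{cases} \]
   Context: Kubilius model: for each prime $p$, $X_p$ is a random variable on $\{0,1,2,\ldots\}$ with $\mathbb P(X_p=k)=p^{-k}(1-1/p)$, and the $X_p$ are mutually independent. For a finite set $T$ of primes, $U_T=\#\{p\in T:X_p\ge1\}$ and $W_T=\sum_{p\in T}X_p$. $H(T)=\sum_{p\in T}1/p$, $H'(T)=\sum_{p\in T}1/(p-1)$, $H''(T)=\sum_{p\in T}1/p^2$. $\mathrm{Pois}(\lambda)$ is a Poisson random variable with parameter $\lambda$. *)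

(* Defs.v *)
From HB Require Import structures.
From mathcomp Require Import all_boot all_order all_algebra.
From mathcomp Require Import all_classical all_reals all_analysis.
From mathcomp Require Import Rstruct.
Set Implicit Arguments. Unset Strict Implicit. Unset Printing Implicit Defensive.
Import Order.TTheory GRing.Theory Num.Theory.
Local Open Scope ring_scope.
Local Open Scope classical_set_scope.

Notation R := Rdefinitions.R.

(* The finite set T of primes is given as a duplicate-free list [T]
   of primes; its i-th prime is [prm T i]. *)
Definition prm (T : seq nat) (i : 'I_(size T)) : nat := nth 0%N T i.
Arguments prm : clear implicits.

(* Law of X_p in the Kubilius model:  P(X_p = k) = p^{-k} (1 - 1/p). *)
Definition kub_pmf (p k : nat) : R := (p%:R^-1) ^+ k * (1 - p%:R^-1).

(* Sample space of (X_p)_{p in T}: a vector of exponents indexed by T. *)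
Definition sample (T : seq nat) := {ffun 'I_(size T) -> nat}.

(* Mutual independence: the joint pmf is the product of the marginals. *)
Definition joint_pmf (T : seq nat) (x : sample T) : R :=
  \prod_(i < size T) kub_pmf (prm T i) (x i).
Arguments joint_pmf : clear implicits.

Definition KProb (T : seq nat) (E : set (sample T)) : R :=
  fine (\esum_(x in E) (joint_pmf T x)%:E).

Definition U_T (T : seq nat) (x : sample T) : nat := #|[set i | (0 < x i)%N]|.
Definition W_T (T : seq nat) (x : sample T) : nat := (\sum_(i < size T) x i)%N.

Definition H_T (T : seq nat) : R := \sum_(p <- T) (p%:R)^-1.
Definition H'_T (T : seq nat) : R := \sum_(p <- T) ((p%:R - 1)^-1).
Definition H''_T (T : seq nat) : R := \sum_(p <- T) ((p%:R ^+ 2)^-1).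

(* P(Pois(lam) = k) = lam^k / k! * e^{-lam}  (also correct for lam = 0). *)
Definition pois_pmf (lam : R) (k : nat) : R := lam ^+ k / (k`!)%:R * expR (- lam).

Definition kub_bound (C H2 H : R) (k : nat) : R :=
  if k%:R <= 19/10 * H then
    C * H2 * pois_pmf H k * ((k.+1)%:R^-1 + ((k%:R - H) / H) ^+ 2)
  else C * H2 * expR (9/10 * H) / (19/10) ^+ k.

(* Main.v *)
(* Formal power series in z are sequences of coefficients, and w = z - 1.  The
   generating function of each summand factors as e^(a w) (1 + w^2 h), where the
   coefficients of h satisfy sum_j |h_j| rho^j = O(a^2) for rho = 1.95.  This
   weighted l^1 norm is submultiplicative, so the generating function of Y is
   e^(H w) (1 + w^2 Q) with sum_j |Q_j| rho^j = O(H''), and the error at k is the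
   k-th coefficient of e^(H w) w^2 Q.  For k > 1.9 H it is bounded by the weighted
   norm at radius 1.9.  For k <= 1.9 H it is a combination of the second
   differences pi(n) ((n - H)^2 - n) / H^2 of the Poisson weights pi at n = k - j,
   and pi(k - j) <= 1.9^j pi(k); the slack between 1.9 and 1.95 absorbs the
   factors 1 + j^2.  The upper limit 2 on rho comes from the pole of the
   generating function of X_2. *)

From HB Require Import structures.
Require Import Defs.
From mathcomp Require Import all_boot all_order all_algebra.
From mathcomp Require Import all_classical all_reals all_analysis.
From mathcomp Require Import Rstruct ring lra zify.
Set Implicit Arguments. Unset Strict Implicit. Unset Printing Implicit Defensive.
Import Order.TTheory GRing.Theory Num.Theory numFieldNormedType.Exports.
Local Open Scope ring_scope.
Local Open Scope classical_set_scope.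

(** * Formal power series and weighted norms *)

(** A separate name for the function type, so that addition is inherited pointwise while [*] becomes
    the Cauchy product. *)
Definition fps := nat -> R.
HB.instance Definition _ := GRing.Zmodule.copy fps (nat -> R).

Definition fps_mul (f g : fps) : fps :=
  fun n => \sum_(i < n.+1) f i * g (n - i)%N.

Definition fpsC (c : R) : fps := fun n => if n == 0%N then c else 0.

(** The n-th coefficient of a product sees only coefficients up to n. Ring laws for series therefore
    follow from those of truncated polynomials. *)
Lemma fps_mul_poly (n : nat) (f g : fps) (p q : {poly R}) :
    (forall i, (i <= n)%N -> p`_i = f i) ->
    (forall i, (i <= n)%N -> q`_i = g i) ->
  fps_mul f g n = (p * q)`_n.
Proof.
move=> pf qg; rewrite coefM; apply: eq_bigr => i _.
by rewrite pf ?qg ?leq_subr // -ltnS.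
Qed.

Definition fps_trunc (n : nat) (f : fps) : {poly R} := \poly_(i < n.+1) f i.

Lemma coef_fps_trunc n f i : (i <= n)%N -> (fps_trunc n f)`_i = f i.
Proof. by move=> lein; rewrite coef_poly ltnS lein. Qed.

Lemma coef_mul_trunc n f g i : (i <= n)%N ->
  (fps_trunc n f * fps_trunc n g)`_i = fps_mul f g i.
Proof.
by move=> lein; rewrite -(@fps_mul_poly _ f g) // => j leji;
  rewrite coef_fps_trunc // (leq_trans leji).
Qed.

Lemma fps_mulA : associative fps_mul.
Proof.
move=> f g h; apply/funext => n.
rewrite (@fps_mul_poly n _ _ (fps_trunc n f) (fps_trunc n g * fps_trunc n h)).
- rewrite mulrA (@fps_mul_poly n _ _ (fps_trunc n f * fps_trunc n g) (fps_trunc n h)) //.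
  + by move=> i; exact: coef_mul_trunc.
  + by move=> i; exact: coef_fps_trunc.
- by move=> i; exact: coef_fps_trunc.
- by move=> i; exact: coef_mul_trunc.
Qed.

Lemma fps_mulC : commutative fps_mul.
Proof.
move=> f g; apply/funext => n.
by rewrite -!(@coef_mul_trunc n) // mulrC.
Qed.

Lemma fpsC_mulE c f n : fps_mul (fpsC c) f n = c * f n.
Proof.
rewrite /fps_mul big_ord_recl /= subn0 big1 ?addr0 // => i _.
by rewrite /fpsC /= mul0r.
Qed.

Lemma fps_mul1 : left_id (fpsC 1) fps_mul.
Proof. by move=> f; apply/funext => n; rewrite fpsC_mulE mul1r. Qed.

Lemma fps_mulDl : left_distributive fps_mul +%R.
Proof.
move=> f g h; apply/funext => n.
rewrite /fps_mul [RHS]/GRing.add /= -big_split /=.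
by apply: eq_bigr => i _; rewrite -mulrDl.
Qed.

Lemma fpsC1_neq0 : fpsC 1 != 0 :> fps.
Proof.
apply/eqP => /(congr1 (fun f : fps => f 0%N)) /eqP.
by rewrite /fpsC /= oner_eq0.
Qed.

HB.instance Definition _ := GRing.Zmodule_isComNzRing.Build fps
  fps_mulA fps_mulC fps_mul1 fps_mulDl fpsC1_neq0.

Lemma fpsME (f g : fps) n : (f * g) n = \sum_(i < n.+1) f i * g (n - i)%N.
Proof. by []. Qed.

Lemma fpsDE (f g : fps) n : (f + g) n = f n + g n. Proof. by []. Qed.

Lemma fpsNE (f : fps) n : (- f) n = - f n. Proof. by []. Qed.

Lemma fps1E n : (1 : fps) n = (n == 0%N)%:R.
Proof. by rewrite /GRing.one /= /fpsC; case: eqP. Qed.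

Lemma fpsCM (c : R) (f : fps) n : (fpsC c * f) n = c * f n.
Proof. exact: fpsC_mulE. Qed.

Definition fpsX : fps := fun n => (n == 1%N)%:R.

Lemma fpsXM (f : fps) n : (fpsX * f) n = if n is m.+1 then f m else 0.
Proof.
rewrite fpsME big_ord_recl /= mul0r add0r; case: n => [|n]; first by rewrite big_ord0.
rewrite big_ord_recl /= mul1r subSS subn0 big1 ?addr0 // => i _.
by rewrite /fpsX /= mul0r.
Qed.

Definition fpsW : fps := fpsX - 1.

Lemma fpsWM (f : fps) n :
  (fpsW * f) n = (if n is m.+1 then f m else 0) - f n.
Proof. by rewrite mulrBl mul1r fpsDE fpsNE fpsXM. Qed.

(** Bounding every partial sum says that the weighted norm at radius r is at most M, without a
    separate convergence claim. *)
Definition wbound (r : R) (f : fps) (M : R) : Prop :=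
  forall n, \sum_(j < n) `|f j| * r ^+ j <= M.

Lemma wbound_le (r : R) f (M N : R) : M <= N -> wbound r f M -> wbound r f N.
Proof. by move=> leMN fM n; exact: le_trans (fM n) leMN. Qed.

Lemma wbound_ge0 (r : R) f M : wbound r f M -> 0 <= M.
Proof. by move/(_ 0%N); rewrite big_ord0. Qed.

Lemma wboundS (r s : R) f M : 0 <= s -> s <= r -> wbound r f M -> wbound s f M.
Proof.
move=> s0 sr fM n; apply: le_trans (fM n); apply: ler_sum => j _.
by rewrite ler_wpM2l // lerXn2r // ?nnegrE // (le_trans s0).
Qed.

Lemma wboundD (r : R) f g M N : 0 <= r ->
  wbound r f M -> wbound r g N -> wbound r (f + g) (M + N).
Proof.
move=> r0 fM gN n; apply: le_trans (lerD (fM n) (gN n)).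
rewrite -big_split /=; apply: ler_sum => j _.
by rewrite -mulrDl ler_wpM2r ?exprn_ge0 // ler_normD.
Qed.

Lemma wboundN (r : R) f M : wbound r f M -> wbound r (- f) M.
Proof.
move=> fM n; apply: le_trans (fM n); apply: ler_sum => j _.
by rewrite fpsNE normrN.
Qed.

Lemma wboundC (r : R) c : wbound r (fpsC c) `|c|.
Proof.
case=> [|n]; first by rewrite big_ord0.
rewrite big_ord_recl /= expr0 mulr1 big1 ?addr0 // => i _.
by rewrite /fpsC /= normr0 mul0r.
Qed.

Lemma wbound1 (r : R) : wbound r 1 1.
Proof. by have := wboundC r 1; rewrite normr1. Qed.

Lemma wboundX (r : R) : 0 <= r -> wbound r fpsX r.
Proof.
move=> r0 n; apply: (@le_trans _ _ (\sum_(j < n) if (j : nat) == 1%N then r else 0)).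
  apply: ler_sum => j _; rewrite /fpsX; case: eqP => [->|_].
    by rewrite normr1 mul1r expr1.
  by rewrite normr0 mul0r.
case: n => [|[|n]]; rewrite ?big_ord0 // ?big_ord_recl ?big_ord0 /= ?addr0 //.
by rewrite add0r big1 ?addr0.
Qed.

Lemma wboundW (r : R) : 0 <= r -> wbound r fpsW (1 + r).
Proof.
move=> r0; rewrite addrC; apply: wboundD => //; first exact: wboundX.
exact/wboundN/wbound1.
Qed.

(** Submultiplicativity: the weight splits as r^k = r^i r^(k-i), and once the double sum is taken
    with i outside, each inner sum is a partial sum of the norm of [g]. *)
Lemma wboundM (r : R) f g M N : 0 <= r ->
  wbound r f M -> wbound r g N -> wbound r (f * g) (M * N).
Proof.
move=> r0 fM gN n.
have M0 := wbound_ge0 fM; have N0 := wbound_ge0 gN.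
apply: (@le_trans _ _ (\sum_(k < n) \sum_(i < n | (i <= k)%N)
   (`|f i| * r ^+ i) * (`|g (k - i)%N| * r ^+ (k - i)))).
  apply: ler_sum => k _; rewrite fpsME.
  apply: (@le_trans _ _ ((\sum_(i < k.+1) `|f i| * `|g (k - i)%N|) * r ^+ k)).
    rewrite ler_wpM2r ?exprn_ge0 //; apply: le_trans (ler_norm_sum _ _ _) _.
    by apply: ler_sum => i _; rewrite normrM.
  rewrite mulr_suml.
  rewrite (big_ord_widen n (fun i => `|f i| * `|g (k - i)%N| * r ^+ k)) //.
  under eq_bigl do rewrite ltnS.
  apply: ler_sum => i leik.
  have -> : r ^+ k = r ^+ i * r ^+ (k - i) by rewrite -exprD subnKC.
  by rewrite mulrACA.
rewrite (exchange_big_dep predT) //=.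
apply: (@le_trans _ _ (\sum_(i < n) (`|f i| * r ^+ i) * N)); last first.
  by rewrite -mulr_suml ler_wpM2r.
apply: ler_sum => i _; rewrite -mulr_sumr ler_wpM2l ?mulr_ge0 ?exprn_ge0 //.
apply: le_trans (gN n).
pose F j := `|g j| * r ^+ j.
have F0 j : 0 <= F j by rewrite mulr_ge0 ?exprn_ge0.
rewrite -(big_mkord (fun k => (i <= k)%N) (fun k => F (k - i)%N)).
rewrite -(big_mkord predT F).
rewrite (@big_cat_nat _ _ _ i) ?(ltnW (ltn_ord i)) //=.
rewrite big_nat_cond big_pred0 ?add0r; last first.
  by move=> k; case: leqP => //; rewrite ?andbF // => h; lia.
rewrite big_nat_cond (eq_bigl (fun k => i <= k < n)%N); last by move=> k; lia.
rewrite -big_nat.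
(* Shifting the index by i leaves the first n - i terms of the norm of [g]; the i terms missing from
   the right-hand sum are nonnegative. *)
rewrite -{1}[val i]add0n big_addn; under eq_bigr do rewrite addnK.
rewrite [leRHS](@big_cat_nat _ _ _ (n - i)) ?leq_subr //=.
by rewrite lerDl sumr_ge0.
Qed.

(** * The Poisson series *)

(** As a series in z this is e^(a(z-1)). Negative a is allowed and yields the multiplicative
    inverse. *)
Definition fps_pois (a : R) : fps := pois_pmf a.

Lemma fact_neq0 n : n`!%:R != 0 :> R.
Proof. by rewrite pnatr_eq0 -lt0n fact_gt0. Qed.

Lemma fps_poisD (a b : R) : fps_pois (a + b) = fps_pois a * fps_pois b.
Proof.
apply/funext => n; rewrite fpsME /fps_pois /pois_pmf addrC exprDn.
rewrite opprD exp.expRD mulr_suml mulr_suml; apply: eq_bigr => i _.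
have lein : (i <= n)%N by rewrite -ltnS.
rewrite -(bin_fact lein) !natrM -mulr_natr.
have := fact_neq0 i; have := fact_neq0 (n - i).
have : 'C(n, i)%:R != 0 :> R by rewrite pnatr_eq0 -lt0n bin_gt0.
by move=> h1 h2 h3; field; rewrite h1 h2 h3.
Qed.

Lemma fps_pois0 : fps_pois 0 = 1.
Proof.
apply/funext => n; rewrite fps1E /fps_pois /pois_pmf oppr0 exp.expR0 mulr1.
by case: n => [|n]; rewrite ?expr0 ?fact0 ?divr1 // expr0n /= mul0r.
Qed.

Lemma fps_poisV (a : R) : fps_pois a * fps_pois (- a) = 1.
Proof. by rewrite -fps_poisD subrr fps_pois0. Qed.

(** * Taylor remainders of the exponential *)

Definition exp_part (K : realType) (x : K) (n : nat) : K := \sum_(j < n) x ^+ j / j`!%:R.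

Lemma exp_partS (K : realType) (x : K) n : exp_part x n.+1 = exp_part x n + x ^+ n / n`!%:R.
Proof. by rewrite /exp_part big_ord_recr. Qed.

Lemma exp_part_series (K : realType) (x : K) : exp_part x = series (exp_coeff x).
Proof. by apply/funext => n; rewrite /exp_part /series /= big_mkord. Qed.

Lemma exp_part_le_expR (K : realType) (x : K) n : 0 <= x -> exp_part x n <= expR x.
Proof.
move=> x0; rewrite exp_part_series /expR.
apply: nondecreasing_cvgn_le; last exact: is_cvg_series_exp_coeff.
apply/nondecreasing_seqP => m; rewrite -exp_part_series exp_partS.
by rewrite lerDl divr_ge0 // exprn_ge0.
Qed.

Lemma fact_leq_addn m n : (m`! * n`! <= (m + n)`!)%N.
Proof.
have := bin_fact (leq_addr n m); rewrite addKn => <-.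
by rewrite leq_pmull // bin_gt0 leq_addr.
Qed.

(** Since n! j! <= (n+j)!, each tail term is at most |x|^n/n! times |x|^j/j!. This bounds every
    finite tail, and the limit preserves the bound. *)
Lemma exp_part_remainder (K : realType) (x : K) n :
  `|expR x - exp_part x n| <= `|x| ^+ n / n`!%:R * expR `|x|.
Proof.
have tail N : `|exp_part x (n + N) - exp_part x n| <=
    `|x| ^+ n / n`!%:R * expR `|x|.
  rewrite /exp_part big_split_ord /= addrAC subrr add0r.
  apply: le_trans (ler_norm_sum _ _ _) _.
  apply: le_trans (ler_wpM2l _ (exp_part_le_expR N (normr_ge0 x))); last first.
    by rewrite divr_ge0 // exprn_ge0.
  rewrite /exp_part mulr_sumr; apply: ler_sum => j _.
  rewrite normrM normfV normrX [X in _ / X]ger0_norm // exprD mulrACA.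
  rewrite ler_wpM2l ?mulr_ge0 ?exprn_ge0 // -invfM lef_pV2 ?posrE.
  - by rewrite -natrM ler_nat fact_leq_addn.
  - by rewrite ltr0n fact_gt0.
  - by rewrite mulr_gt0 // ltr0n fact_gt0.
have cv : `|exp_part x m - exp_part x n| @[m --> \oo] --> `|expR x - exp_part x n|.
  apply: cvg_norm; apply: cvgB; last exact: cvg_cst.
  by rewrite exp_part_series; exact: is_cvg_series_exp_coeff.
apply: (cvgr_to_le cv); near=> m.
have lenm : (n <= m)%N by near: m; exact: nbhs_infty_ge.
by rewrite -(subnKC lenm).
Unshelve. all: by end_near. Qed.

Definition exp_rem (a : R) (n : nat) : R := exp_part (- a) n - expR (- a).

Lemma exp_remS a n : exp_rem a n.+1 = exp_rem a n + (- a) ^+ n / n`!%:R.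
Proof. by rewrite /exp_rem exp_partS addrAC. Qed.

(* The coefficients of [(e^(-a(z-1)) - 1 + a(z-1)) / (z-1)^2], in closed form. *)
Definition fps_phi (a : R) : fps :=
  fun n => expR a * (n.+1%:R * exp_rem a n.+1 + a * exp_rem a n).

(** Multiplication by w takes differences of consecutive coefficients. The first one turns [fps_phi]
    into multiples of [exp_rem], the second turns these into the Taylor terms of e^(-aw); the linear
    part 1 - aw corrects coefficients 0 and 1. *)
Lemma fps_phiE (a : R) :
  fps_pois (- a) = 1 - fpsC a * fpsW + fpsW * (fpsW * fps_phi a).
Proof.
have ea : expR a * expR (- a) = 1 by rewrite exp.expRN divff // gt_eqF // expR_gt0.
have diff n : fps_phi a n.+1 - fps_phi a n = expR a * exp_rem a n.+2.
  rewrite /fps_phi (exp_remS a n.+1) (exp_remS a n) factS natrM exprS.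
  have := fact_neq0 n; have : n.+1%:R != 0 :> R by rewrite pnatr_eq0.
  rewrite -(natr1 n.+1).
  by move: (n.+1%:R : R) (n`!%:R : R) => m f h1 h2; field; rewrite h1 h2.
have r0 : exp_rem a 0 = - expR (- a) by rewrite /exp_rem /exp_part big_ord0 sub0r.
have r1 : exp_rem a 1 = 1 - expR (- a).
  by rewrite exp_remS r0 expr0 fact0 divr1 addrC.
have phi0 : fps_phi a 0 = expR a - 1 - a.
  rewrite /fps_phi r0 r1 mul1r mulrDr mulrBr ea mulr1 mulrCA mulrN ea.
  by rewrite mulrN1.
have W1 n : (fpsW * fps_phi a) n = (n == 0%N)%:R * a - expR a * exp_rem a n.+1.
  rewrite fpsWM; case: n => [|n].
    by rewrite phi0 r1 mulrBr ea eqxx /=; ring.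
  by rewrite mul0r sub0r -diff opprB.
apply/funext => n; rewrite !fpsDE fpsNE fps1E fpsCM fpsWM.
have -> : fpsW n = (n == 1%N)%:R - (n == 0%N)%:R.
  by rewrite /fpsW fpsDE fpsNE fps1E.
rewrite /fps_pois /pois_pmf opprK.
have er1 : expR a * exp_rem a 1 = expR a - 1 by rewrite r1 mulrBr ea mulr1.
case: n => [|[|n]]; rewrite !W1 /=.
- by rewrite er1 expr0 fact0; field.
- by rewrite (exp_remS a 1) factS fact0; field.
- by rewrite (exp_remS a n.+2); ring.
Qed.

Lemma fps_phi_bound (a : R) n : 0 <= a -> a <= 1 ->
  `|fps_phi a n| <= 2 * expR 1 ^+ 2 * a ^+ 2 / n`!%:R.
Proof.
move=> a0 a1.
have e1 : 1 <= expR 1 :> R by rewrite ltW // expR_gt1.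
have rb m : `|exp_rem a m| <= expR 1 * a ^+ m / m`!%:R.
  rewrite distrC; apply: le_trans (exp_part_remainder _ _) _.
  rewrite normrN ger0_norm // mulrC mulrA ler_wpM2r // ler_wpM2r ?exprn_ge0 //.
  by rewrite ler_expR.
have eale : expR a <= expR 1 by rewrite ler_expR.
have ea0 := expR_gt0 a.
suff : `|n.+1%:R * exp_rem a n.+1 + a * exp_rem a n| <=
    2 * expR 1 * a ^+ 2 / n`!%:R.
  move=> h; rewrite normrM gtr0_norm //.
  apply: le_trans (ler_pM (ltW ea0) (normr_ge0 _) eale h) _.
  by rewrite le_eqVlt; apply/orP; left; apply/eqP; ring.
case: n => [|n].
  (* The two original terms are each only O(a); after regrouping both are O(a^2). *)
  have -> : 1%:R * exp_rem a 1 + a * exp_rem a 0 = exp_rem a 2 + a * exp_rem a 1.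
    by rewrite (exp_remS a 1) (exp_remS a 0) expr0 expr1 fact0; ring.
  apply: le_trans (ler_normD _ _) _; rewrite normrM (ger0_norm a0).
  have h2 := rb 2%N; have h1 := ler_wpM2l a0 (rb 1%N).
  rewrite !factS !fact0 in h1 h2 *; nra.
apply: le_trans (ler_normD _ _) _; rewrite !normrM (ger0_norm a0) ger0_norm //.
have h1 := ler_wpM2l (ler0n R n.+2) (rb n.+2).
have h2 := ler_wpM2l a0 (rb n.+1).
apply: le_trans (lerD h1 h2) _.
have f0 : 0 < n.+1`!%:R :> R by rewrite ltr0n fact_gt0.
have -> : n.+2%:R * (expR 1 * a ^+ n.+2 / (n.+2)`!%:R) +
   a * (expR 1 * a ^+ n.+1 / (n.+1)`!%:R) = 2 * expR 1 * a ^+ 2 / (n.+1)`!%:R * a ^+ n.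
  rewrite factS natrM !exprS; have : n.+2%:R != 0 :> R by rewrite pnatr_eq0.
  move: (gt_eqF f0) => /negbT; move: (n.+2%:R : R) (n.+1`!%:R : R) => m f nzf nzm.
  by field; rewrite nzf nzm.
rewrite ler_piMr ?exprn_ile1 // divr_ge0 // mulr_ge0 ?exprn_ge0 //.
Qed.

Lemma wbound_phi (r a : R) : 0 <= r -> 0 <= a -> a <= 1 ->
  wbound r (fps_phi a) (2 * expR 1 ^+ 2 * expR r * a ^+ 2).
Proof.
move=> r0 a0 a1 n.
apply: le_trans (_ : 2 * expR 1 ^+ 2 * a ^+ 2 * exp_part r n <= _).
  rewrite /exp_part mulr_sumr; apply: ler_sum => j _.
  apply: le_trans (ler_wpM2r (exprn_ge0 j r0) (fps_phi_bound j a0 a1)) _.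
  by rewrite le_eqVlt; apply/orP; left; apply/eqP; ring.
rewrite mulrAC ler_wpM2r ?exprn_ge0 // ler_wpM2l ?exp_part_le_expR //.
Qed.

Lemma wbound_pois (r a : R) : 0 <= r -> 0 <= a ->
  wbound r (fps_pois a) (expR ((r - 1) * a)).
Proof.
move=> r0 a0 n.
rewrite mulrBl mul1r exp.expRD.
apply: le_trans (ler_wpM2r (expR_ge0 (- a)) (exp_part_le_expR n (mulr_ge0 r0 a0))).
rewrite /exp_part mulr_suml; apply: ler_sum => j _.
rewrite /fps_pois /pois_pmf ger0_norm; last first.
  by rewrite mulr_ge0 ?expR_ge0 // divr_ge0 // exprn_ge0.
by rewrite le_eqVlt; apply/orP; left; apply/eqP; rewrite exprMn; ring.
Qed.

(** * Factorization and coefficient bounds *)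

(** The series (1 - q)/(1 - qz), which for q = 1/p is the generating function of X_p. *)
Definition fps_geom (q : R) : fps := fun n => q ^+ n * (1 - q).

(** Insert 1 = e^(aw) e^(-aw) and expand e^(-aw) = 1 - aw + w^2 phi: the linear terms of (1 + aw)(1
    - aw + w^2 phi) cancel. *)
Lemma bernoulli_factor (a : R) :
  1 + fpsC a * fpsW = fps_pois a * (1 + fpsW * (fpsW *
    ((1 + fpsC a * fpsW) * fps_phi a - fpsC a * fpsC a))).
Proof.
transitivity (fps_pois a * (fps_pois (- a) * (1 + fpsC a * fpsW))).
  by rewrite mulrA fps_poisV mul1r.
by rewrite fps_phiE; congr (_ * _); ring.
Qed.

Lemma wbound_bernoulli_factor (r a : R) : 0 <= r -> 0 <= a -> a <= 1 ->
  wbound r ((1 + fpsC a * fpsW) * fps_phi a - fpsC a * fpsC a)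
    (((2 + r) * (2 * expR 1 ^+ 2 * expR r) + 1) * a ^+ 2).
Proof.
move=> r0 a0 a1.
have aE : `|a| = a by rewrite ger0_norm.
have h1 : wbound r (1 + fpsC a * fpsW) (1 + `|a| * (1 + r)).
  apply: wboundD => //; first exact: wbound1.
  by apply: wboundM => //; [exact: wboundC | exact: wboundW].
have h2 := wboundM r0 h1 (wbound_phi r0 a0 a1).
have h3 := wboundM r0 (wboundC r a) (wboundC r a).
apply: wbound_le (wboundD r0 h2 (wboundN h3)); rewrite aE.
set K := 2 * expR 1 ^+ 2 * expR r.
have K0 : 0 <= K by rewrite !mulr_ge0 // ?expR_ge0.
have -> : (1 + a * (1 + r)) * (K * a ^+ 2) + a * a =
  ((1 + a * (1 + r)) * K + 1) * a ^+ 2 by ring.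
rewrite ler_wpM2r ?exprn_ge0 // lerD2r ler_wpM2r //; nra.
Qed.

Lemma fps_geomV (q : R) : 1 - q != 0 ->
  fps_geom q * (1 - fpsC (q / (1 - q)) * fpsW) = 1.
Proof.
move=> q1; have -> : fps_geom q * (1 - fpsC (q / (1 - q)) * fpsW) =
  fps_geom q - fpsC (q / (1 - q)) * (fpsW * fps_geom q) by ring.
apply/funext => n; rewrite fpsDE fpsNE fpsCM fpsWM fps1E /fps_geom.
case: n => [|n] /=; first by rewrite expr0; field.
by rewrite exprS; field.
Qed.

(** As 1 - qz = (1 - q) - qw, the series [fps_geom q] is the inverse of 1 - aw. The part 1 - aw of
    e^(-aw) thus contributes exactly 1. For q = 1/p the parameter a is 1/(p-1), whence H'. *)
Lemma geometric_factor (q : R) : 1 - q != 0 ->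
  let a := q / (1 - q) in
  fps_geom q = fps_pois a * (1 + fpsW * (fpsW * (fps_geom q * fps_phi a))).
Proof.
move=> q1 a.
have E : fps_pois (- a) * fps_geom q =
    1 + fpsW * (fpsW * (fps_geom q * fps_phi a)).
  transitivity (fps_geom q * (1 - fpsC a * fpsW) +
      fpsW * (fpsW * (fps_geom q * fps_phi a))); last by rewrite fps_geomV.
  by rewrite fps_phiE; ring.
by rewrite -E mulrA fps_poisV mul1r.
Qed.

Lemma sum_expr_le (x : R) n : 0 <= x -> x < 1 ->
  \sum_(j < n) x ^+ j <= (1 - x)^-1.
Proof.
move=> x0 x1; rewrite -div1r ler_pdivlMr ?subr_gt0 //.
have -> : (\sum_(j < n) x ^+ j) * (1 - x) = 1 - x ^+ n.
  by rewrite -[1 - x ^+ n]opprB subrX1 -mulNr opprB mulrC.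
by rewrite gerBl exprn_ge0.
Qed.

Lemma wbound_geom (r q : R) : 0 <= r -> 0 <= q -> q <= 1 -> r * q < 1 ->
  wbound r (fps_geom q) (1 - r * q)^-1.
Proof.
move=> r0 q0 q1 rq1 n; apply: le_trans (sum_expr_le n (mulr_ge0 r0 q0) rq1).
apply: ler_sum => j _; rewrite /fps_geom ger0_norm; last first.
  by rewrite mulr_ge0 ?exprn_ge0 // subr_ge0.
rewrite exprMn mulrAC [r ^+ j * _]mulrC ler_piMr ?mulr_ge0 ?exprn_ge0 //.
by rewrite gerBl.
Qed.

(** Induction by (1 + w^2 h)(1 + w^2 Q) = 1 + w^2 (h + Q + w^2 h Q). As w has norm at most 1 + r,
    the cross term costs a factor 1 + (1+r)^2 m, which the exponential absorbs through 1 + x <=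
    e^x. *)
Lemma prod_factor (I : eqType) (r : R) (s : seq I) (F h : I -> fps) (a m : I -> R) :
    0 <= r ->
    (forall i, i \in s -> F i = fps_pois (a i) * (1 + fpsW * (fpsW * h i))) ->
    (forall i, i \in s -> wbound r (h i) (m i)) ->
  exists2 Q : fps,
    \prod_(i <- s) F i =
      fps_pois (\sum_(i <- s) a i) * (1 + fpsW * (fpsW * Q)) &
    wbound r Q ((\sum_(i <- s) m i) *
      expR ((1 + r) ^+ 2 * \sum_(i <- s) m i)).
Proof.
move=> r0; elim: s => [|i s IH] FE hm.
  exists 0; first by rewrite !big_nil fps_pois0 !mulr0 addr0 mulr1.
  by move=> n; rewrite big_nil mul0r big1 // => j _; rewrite normr0 mul0r.
have is_s j : j \in s -> j \in i :: s by rewrite in_cons => ->; rewrite orbT.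
have [Q QE Qb] := IH (fun j js => FE j (is_s j js)) (fun j js => hm j (is_s j js)).
have {}hm_i := hm i (mem_head i s).
exists (h i + Q + fpsW * (fpsW * (h i * Q))).
  by rewrite !big_cons QE FE ?mem_head // fps_poisD; ring.
have mi0 : 0 <= m i := wbound_ge0 hm_i.
rewrite !big_cons; set S := \sum_(j <- s) m j in Qb *.
have S0 : 0 <= S.
  by rewrite /S big_seq sumr_ge0 // => j /is_s /hm /wbound_ge0.
have Wb := wboundW r0.
apply: wbound_le (wboundD r0 (wboundD r0 hm_i Qb)
  (wboundM r0 Wb (wboundM r0 Wb (wboundM r0 hm_i Qb)))).
set c := (1 + r) ^+ 2; set E := expR (c * S).
have c0 : 0 <= c by rewrite exprn_ge0 // addr_ge0.
have E1 : 1 <= E by rewrite -exp.expR0 ler_expR mulr_ge0.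
rewrite mulrDr exp.expRD -/E; set G := expR (c * m i).
have G1 : 1 + c * m i <= G by exact: exp.expR_ge1Dx.
have -> : m i + S * E + (1 + r) * ((1 + r) * (m i * (S * E))) =
   m i + (S * E) * (1 + c * m i) by rewrite /c; ring.
rewrite [leRHS](_ : _ = m i * (G * E) + (S * E) * G); last by ring.
have cm : 0 <= c * m i by rewrite mulr_ge0.
have SE : 0 <= S * E by rewrite mulr_ge0 // (le_trans ler01).
apply: lerD; last by rewrite ler_wpM2l.
rewrite ler_peMr // -[1]mul1r ler_pM //.
by apply: le_trans G1; rewrite lerDl.
Qed.

(** * Poisson weights, their second differences and the two error ranges *)

Lemma fps_poisS (H : R) n : fps_pois H n.+1 * n.+1%:R = H * fps_pois H n.
Proof.
rewrite /fps_pois /pois_pmf exprS factS natrM.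
have := fact_neq0 n; have : n.+1%:R != 0 :> R by rewrite pnatr_eq0.
by move: (n.+1%:R : R) (n`!%:R : R) => m f h1 h2; field; rewrite h1 h2.
Qed.

Lemma fps_pois_ge0 (H : R) n : 0 <= H -> 0 <= fps_pois H n.
Proof.
by move=> H0; rewrite /fps_pois /pois_pmf mulr_ge0 ?expR_ge0 // divr_ge0 // exprn_ge0.
Qed.

(** Two uses of the ratio rule [fps_poisS] reduce all three weights to the one at n. The factor H^2
    stands on the left so that no division by H occurs. *)
Lemma fps_pois_diff2 (H : R) n :
  (fpsW * (fpsW * fps_pois H)) n * H ^+ 2 =
  fps_pois H n * ((n%:R - H) ^+ 2 - n%:R).
Proof.
rewrite !fpsWM; case: n => [|[|n]] /=; rewrite ?fpsWM; first by ring.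
  by have := fps_poisS H 0; rewrite mulr1 => ->; ring.
have h1 := fps_poisS H n.+1; have h2 := fps_poisS H n.
set p2 := fps_pois H n.+2 in h1 *; set p1 := fps_pois H n.+1 in h1 h2 *.
set p0 := fps_pois H n in h2 *.
have -> : (p0 - p1 - (p1 - p2)) * H ^+ 2 =
  H * (H * p0) - 2 * H * (H * p1) + H ^+ 2 * p2 by ring.
rewrite -h1 -h2 mulrA -h1 -!natr1; ring.
Qed.

(** Here 39/38 = 1.95/1.9. Bernoulli's inequality gives 1 + j/80 <= (81/80)^j, and (81/80)^2 <=
    39/38; hence j^2 <= 6400 (39/38)^j, and the remaining 1 costs one more. *)
Lemma sq_le_expr j : 1 + j%:R ^+ 2 <= 6401 * (39 / 38) ^+ j :> R.
Proof.
have b : 1 + j%:R / 80 <= (81 / 80) ^+ j :> R.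
  elim: j => [|j IH]; first by rewrite expr0 mul0r addr0.
  rewrite exprS -natr1; have := ler0n R j; nra.
have : ((81 / 80) ^+ j) ^+ 2 <= (39 / 38) ^+ j :> R.
  rewrite -exprM mulnC exprM lerXn2r // ?nnegrE; lra.
have := ler0n R j; nra.
Qed.

(** A step down from m <= k multiplies the weight by m/H <= 1.9. *)
Lemma fps_pois_shift (H : R) k j : 0 < H -> k%:R <= 19 / 10 * H -> (j <= k)%N ->
  fps_pois H (k - j)%N <= fps_pois H k * (19 / 10) ^+ j.
Proof.
move=> H0 kH; elim: j => [|j IH] ltjk; first by rewrite subn0 expr0 mulr1.
have {}IH := IH (ltnW ltjk).
have E : (k - j = (k - j.+1).+1)%N by lia.
have := fps_poisS H (k - j.+1)%N; rewrite -E => S1.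
have p0 := fps_pois_ge0 (k - j)%N (ltW H0).
have le1 : (k - j)%:R <= 19 / 10 * H.
  by apply: le_trans kH; rewrite ler_nat leq_subr.
suff : fps_pois H (k - j.+1)%N <= 19 / 10 * fps_pois H (k - j)%N.
  by rewrite exprS => h; apply: le_trans h _; rewrite [leRHS]mulrCA ler_wpM2l //; lra.
rewrite -(ler_pM2l H0) -S1; nra.
Qed.

Lemma wbound_coef (r : R) (f : fps) M n : 0 <= r -> wbound r f M ->
  `|f n| * r ^+ n <= M.
Proof.
move=> r0 /(_ n.+1); rewrite big_ord_recr /=; apply: le_trans.
by rewrite lerDr sumr_ge0 // => i _; rewrite mulr_ge0 ?exprn_ge0.
Qed.

(** Used with x = k and y = j. With u = 1/H and z = (x-H)/H the left side is (z - uy)^2 + u^2 x. Now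
    (z - uy)^2 <= 2z^2 + 2u^2 y^2, and from x >= 1 and ux <= 1.9 both u^2 and u^2 x are at most
    7.22/(x+1). *)
Lemma quadratic_weight_le (H x y : R) : 0 < H -> 1 <= x -> x <= 19 / 10 * H ->
  0 <= y -> ((x - y - H) ^+ 2 + x) / H ^+ 2 <=
    16 * (1 + y ^+ 2) * ((x + 1)^-1 + ((x - H) / H) ^+ 2).
Proof.
move=> H0 x1 xH y0.
set t := (x + 1)^-1; set z := (x - H) / H.
have x0 : 0 < x by lra.
have tE : t * (x + 1) = 1 by rewrite mulVf //; apply/eqP; lra.
have t0 : 0 < t by rewrite invr_gt0; lra.
set u := H^-1.
have uE : u * H = 1 by rewrite mulVf // gt_eqF.
have u0 : 0 < u by rewrite invr_gt0.
have ux : u * x <= 19 / 10.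
  by have := ler_wpM2l (ltW u0) xH; rewrite mulrCA uE mulr1.
have ux0 : 0 <= u * x by rewrite mulr_ge0 // ltW.
have zE : z = u * (x - H) by rewrite /z mulrC.
have -> : ((x - y - H) ^+ 2 + x) / H ^+ 2 = (z - u * y) ^+ 2 + u ^+ 2 * x.
  by rewrite zE -exprVn -/u; ring.
have ux2 : (u * x) ^+ 2 <= 361 / 100 by nra.
have uu0 : 0 <= u ^+ 2 by exact: sqr_ge0.
have a1 : u ^+ 2 <= u ^+ 2 * x by rewrite ler_peMr.
have a2 : u ^+ 2 * x <= (u * x) ^+ 2.
  by rewrite exprMn ler_wpM2l // expr2 ler_peMr // ltW.
have u2x : u ^+ 2 * x <= 722 / 100 * t.
  have : u ^+ 2 * x * (x + 1) <= 722 / 100.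
    by rewrite mulrDr mulr1 -mulrA -expr2 -exprMn; lra.
  move/(ler_wpM2l (ltW t0)); rewrite [leLHS]mulrCA [t * (_ / _)]mulrC tE mulr1.
  by [].
have u2 : u ^+ 2 <= 722 / 100 * t by exact: le_trans a1 u2x.
have : (u * y) ^+ 2 <= 722 / 100 * t * y ^+ 2.
  by rewrite exprMn ler_wpM2r // exprn_ge0.
have : (z - u * y) ^+ 2 <= 2 * z ^+ 2 + 2 * (u * y) ^+ 2.
  rewrite [leRHS](_ : _ = (z - u * y) ^+ 2 + (z + u * y) ^+ 2); last by ring.
  by rewrite lerDl sqr_ge0.
have : 0 <= t * y ^+ 2 by rewrite mulr_ge0 ?exprn_ge0 // ltW.
have : 0 <= z ^+ 2 * y ^+ 2 by rewrite mulr_ge0 ?sqr_ge0.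
have := sqr_ge0 z; lra.
Qed.

(** The factor 16 comes from [quadratic_weight_le], 6401 from [sq_le_expr]. *)
Definition near_mode_const : R := 16 * 6401.

Lemma near_mode_const_ge9 : 9 <= near_mode_const.
Proof. rewrite /near_mode_const; lra. Qed.

Lemma near_mode_bound (H M : R) (Q : fps) k :
    0 <= H -> wbound (39 / 20) Q M -> k%:R <= 19 / 10 * H ->
  `|(fps_pois H * (fpsW * (fpsW * Q))) k| <=
    near_mode_const * M * fps_pois H k * (k.+1%:R^-1 + ((k%:R - H) / H) ^+ 2).
Proof.
move=> H0 Qb kH; have M0 := wbound_ge0 Qb; have K9 := near_mode_const_ge9.
have K0 : 0 <= near_mode_const by lra.
have r0 : 0 <= 39 / 20 :> R by lra.
(* Moving w^2 onto the Poisson series produces the second differences. *)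
have -> : fps_pois H * (fpsW * (fpsW * Q)) = Q * (fpsW * (fpsW * fps_pois H)).
  by ring.
have p0 n := fps_pois_ge0 n H0.
set P := fpsW * (fpsW * fps_pois H); rewrite fpsME.
(* At k = 0 the mean H may vanish, and [quadratic_weight_le] needs k >= 1; only the constant
   coefficients of Q and [P] enter there. *)
case: k kH => [|k] kH.
  have := wbound_coef 0%N r0 Qb; rewrite expr0 mulr1 => Q0.
  rewrite big_ord1 subnn /P !fpsWM !sub0r opprK normrM (ger0_norm (p0 _)).
  rewrite invr1.
  set B := (- H / H) ^+ 2; have : 0 <= B by exact: sqr_ge0.
  have := p0 0%N; set p := fps_pois H 0 => pp BB.
  apply: (@le_trans _ _ (M * (p * 1))); first by rewrite mulr1 ler_wpM2r.
  apply: (@le_trans _ _ (M * (p * (1 + B)))).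
    by rewrite ler_wpM2l // ler_wpM2l // lerDl.
  rewrite [leRHS](_ : _ = near_mode_const * (M * (p * (1 + B)))); last by ring.
  by rewrite ler_peMl ?mulr_ge0 //; lra.
have k0 : 1 <= k.+1%:R :> R by rewrite ler1n.
have Hp : 0 < H by lra.
set B := (_ + _); set p := fps_pois H k.+1.
have B0 : 0 <= B by rewrite addr_ge0 // sqr_ge0.
(* The shift of the Poisson weight costs 1.9^j and the quadratic weight 1 + j^2; together they fit
   under 1.95^j, the weight in the norm of Q. *)
have PB j : (j <= k.+1)%N -> `|P (k.+1 - j)%N| <= near_mode_const * p * B * (39 / 20) ^+ j.
  move=> lejk; set n := (k.+1 - j)%N.
  have nE : n%:R = k.+1%:R - j%:R :> R by rewrite natrB.
  have H2 : 0 < H ^+ 2 by rewrite exprn_gt0.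
  have -> : P n = fps_pois H n * (((n%:R - H) ^+ 2 - n%:R) / H ^+ 2).
    by rewrite mulrA -fps_pois_diff2 mulfK // gt_eqF.
  rewrite normrM (ger0_norm (p0 _)).
  have wle : `|((n%:R - H) ^+ 2 - n%:R) / H ^+ 2| <= 16 * (1 + j%:R ^+ 2) * B.
    rewrite /B -(natr1 k.+1).
    apply: le_trans (quadratic_weight_le Hp k0 kH (ler0n _ j)).
    rewrite normrM [X in _ * X]ger0_norm ?invr_ge0 ?(ltW H2) //.
    rewrite ler_wpM2r ?invr_ge0 ?(ltW H2) // nE.
    have j0 := ler0n R j; have n0 := ler0n R n; rewrite nE in n0.
    have s0 := sqr_ge0 (k.+1%:R - j%:R - H).
    rewrite ler_norml; apply/andP; split; lra.
  have sh := fps_pois_shift Hp kH lejk.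
  apply: le_trans (ler_pM (p0 _) (normr_ge0 _) sh wle) _.
  have -> : (39 / 20) ^+ j = (19 / 10) ^+ j * (39 / 38) ^+ j :> R.
    by rewrite -exprMn; congr (_ ^+ _); lra.
  have e0 : 0 <= (19 / 10) ^+ j :> R by rewrite exprn_ge0 //; lra.
  rewrite [leLHS](_ : _ = (p * B * (19 / 10) ^+ j) * 16 * (1 + j%:R ^+ 2)); last first.
    by rewrite /p; ring.
  rewrite [leRHS](_ : _ = (p * B * (19 / 10) ^+ j) * 16 * (6401 * (39 / 38) ^+ j)); last first.
    by rewrite /near_mode_const; ring.
  rewrite ler_wpM2l ?sq_le_expr //.
  by rewrite mulr_ge0 // mulr_ge0 // mulr_ge0 //; exact: p0.
apply: le_trans (ler_norm_sum _ _ _) _.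
apply: (@le_trans _ _ (near_mode_const * p * B * \sum_(j < k.+2) `|Q j| * (39 / 20) ^+ j)).
  rewrite mulr_sumr; apply: ler_sum => j _; rewrite normrM mulrCA ler_wpM2l //.
  by apply: PB; rewrite -ltnS.
have pB : 0 <= near_mode_const * p * B.
  by rewrite mulr_ge0 // mulr_ge0 //; exact: p0.
rewrite [leRHS](_ : _ = near_mode_const * p * B * M); last by ring.
by rewrite ler_wpM2l.
Qed.

(** One coefficient is at most the norm divided by 1.9^k. At radius 1.9 the Poisson series has norm
    at most e^(0.9H) and w^2 at most 2.9^2 <= 9. *)
Lemma tail_bound (H M : R) (Q : fps) k :
    0 <= H -> wbound (39 / 20) Q M ->
  `|(fps_pois H * (fpsW * (fpsW * Q))) k| <=
    9 * M * expR (9 / 10 * H) / (19 / 10) ^+ k.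
Proof.
move=> H0 Qb; have M0 := wbound_ge0 Qb.
have r0 : 0 <= 19 / 10 :> R by lra.
have rr : 19 / 10 <= 39 / 20 :> R by lra.
have Wb := wboundW r0.
have := wboundM r0 (wbound_pois r0 H0)
  (wboundM r0 Wb (wboundM r0 Wb (wboundS r0 rr Qb))).
move/(wbound_coef k r0) => h.
rewrite ler_pdivlMr; last by rewrite exprn_gt0 //; lra.
apply: le_trans h _.
have -> : (19 / 10 - 1) * H = 9 / 10 * H by lra.
have := mulr_ge0 (expR_ge0 (9 / 10 * H)) M0; nra.
Qed.

(** * Probabilities as coefficients *)

Lemma esumZl_le (K : realType) (T : choiceType) (A : set T) (c : K) (a : T -> \bar K) :
    0 <= c -> (forall x, 0 <= a x)%E ->
  (\esum_(x in A) (c%:E * a x) <= c%:E * \esum_(x in A) a x)%E.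
Proof.
move=> c0 a0; apply: ge_ereal_sup => _ [X XA <-].
rewrite -ge0_mule_fsumr //; apply: lee_wpmul2l; first by rewrite lee_fin.
by apply: esum_ge; exists X.
Qed.

(** For c != 0 the reverse inequality is the one-sided version applied to the scaled family with
    factor 1/c. *)
Lemma ge0_esumZl (K : realType) (T : choiceType) (A : set T) (c : K) (a : T -> \bar K) :
    0 <= c -> (forall x, 0 <= a x)%E ->
  (\esum_(x in A) (c%:E * a x) = c%:E * \esum_(x in A) a x)%E.
Proof.
move=> c0 a0; apply/eqP; rewrite eq_le esumZl_le //=.
have ca0 x : (0 <= c%:E * a x)%E by rewrite mule_ge0 // lee_fin.
case: (eqVneq c 0) => [->|cn0].
  by rewrite mul0e; apply: esum_ge0 => x _; rewrite mul0e.
have cV : (c%:E * (c^-1)%:E = 1)%E by rewrite -EFinM divff.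
rewrite [X in (_ * X <= _)%E](_ : _ = \esum_(x in A) ((c^-1)%:E * (c%:E * a x))%E); last first.
  by apply: eq_esum => x _; rewrite muleA [((c^-1)%:E * _)%E]muleC cV mul1e.
rewrite -[leRHS]mul1e -cV -muleA; apply: lee_wpmul2l; first by rewrite lee_fin.
by apply: esumZl_le => //; rewrite invr_ge0.
Qed.

Lemma esum_prod (K : realType) (T1 T2 : choiceType) (A : set T1) (B : set T2)
    (f : T1 -> K) (g : T2 -> K) (u v : K) :
    (forall x, 0 <= f x) -> (forall y, 0 <= g y) ->
    (\esum_(x in A) (f x)%:E = u%:E)%E -> (\esum_(y in B) (g y)%:E = v%:E)%E ->
  (\esum_(z in A `*` B) (f z.1 * g z.2)%:E = (u * v)%:E)%E.
Proof.
move=> f0 g0 fu gv.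
have v0 : 0 <= v by rewrite -lee_fin -gv esum_ge0 // => y _; rewrite lee_fin.
have -> : A `*` B = A `*`` (fun=> B) by apply/seteqP; split=> -[].
rewrite -(@esum_esum _ _ _ A (fun=> B) (fun x y => (f x * g y)%:E)); last first.
  by move=> x y _ _; rewrite lee_fin mulr_ge0.
have inner x : (\esum_(y in B) (f x * g y)%:E = v%:E * (f x)%:E)%E.
  rewrite muleC -gv -(@ge0_esumZl _ _ B (f x) (fun y => (g y)%:E)) //.
under eq_esum do rewrite inner.
rewrite (@ge0_esumZl _ _ A v (fun x => (f x)%:E)) ?fu -?EFinM 1?mulrC //.
Qed.

Definition ffun_cons n (z : nat * {ffun 'I_n -> nat}) : {ffun 'I_n.+1 -> nat} :=
  [ffun i => if unlift ord0 i is Some j then z.2 j else z.1].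

Lemma ffun_cons0 n (z : nat * {ffun 'I_n -> nat}) : ffun_cons z ord0 = z.1.
Proof. by rewrite ffunE unlift_none. Qed.

Lemma ffun_consS n (z : nat * {ffun 'I_n -> nat}) j :
  ffun_cons z (lift ord0 j) = z.2 j.
Proof. by rewrite ffunE liftK. Qed.

Lemma ffun_cons_inj n : injective (@ffun_cons n).
Proof.
move=> [a x] [b y] /ffunP E; congr (_, _).
  by have := E ord0; rewrite !ffun_cons0.
by apply/ffunP => j; have := E (lift ord0 j); rewrite !ffun_consS.
Qed.

Lemma ffun_cons_surj n (x : {ffun 'I_n.+1 -> nat}) :
  x = ffun_cons (x ord0, [ffun j => x (lift ord0 j)]).
Proof.
apply/ffunP => i; rewrite ffunE; case: unliftP => [j|] -> //=.
by rewrite ffunE.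
Qed.

(** Independence makes generating functions multiply. The level set is split by the value m of [s]
    at the first coordinate; each piece is a product set up to [ffun_cons], and summing over m <= k
    gives a Cauchy product. Taking [s] as the identity or as the indicator of j > 0 covers W_T and
    U_T. *)
Lemma esum_level_prod n (s : nat -> nat) (f : 'I_n -> nat -> R) (F : 'I_n -> fps) k :
    (forall i j, 0 <= f i j) ->
    (forall i m, (\esum_(j in [set j | s j == m]) (f i j)%:E = (F i m)%:E)%E) ->
  (\esum_(x in [set x : {ffun 'I_n -> nat} | (\sum_i s (x i))%N == k])
     (\prod_i f i (x i))%:E = ((\prod_i F i) k)%:E)%E.
Proof.
elim: n f F k => [|n IH] f F k f0 fF.
  rewrite big_ord0 fps1E.
  have one x : (\prod_i f i (x i)) = 1 by rewrite big_ord0.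
  under eq_esum do rewrite one.
  case: k => [|k].
    rewrite (_ : [set x | _] = [set [ffun i => 0%N]]) ?esum_set1 ?lee_fin //.
    by apply/seteqP; split=> x _ /=; [apply/ffunP; case|rewrite big_ord0].
  rewrite (_ : [set x | _] = set0) ?esum_set0 //.
  by apply/seteqP; split=> x //=; rewrite big_ord0.
pose J m := [set x : {ffun 'I_n.+1 -> nat} |
  s (x ord0) = m /\ (\sum_i s (x (lift ord0 i)) = k - m)%N].
rewrite (_ : [set x | _] = \bigcup_(m in `I_k.+1) J m); last first.
  apply/seteqP; split=> x /=.
    rewrite big_ord_recl => /eqP kE; exists (s (x ord0)) => /=.
      by rewrite -kE ltnS leq_addr.
    by split=> //; rewrite -kE addKn.
  move=> [m /= ltmk [sm sE]]; rewrite big_ord_recl sm sE subnKC //.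
rewrite esum_bigcupT; last 2 first.
- by move=> i j _ _ [x [[<- _] [<- _]]].
- by move=> x; rewrite lee_fin prodr_ge0.
have JE m : (\esum_(x in J m) (\prod_i f i (x i))%:E =
    (F ord0 m * (\prod_i F (lift ord0 i)) (k - m)%N)%:E)%E.
  rewrite (@reindex_esum _ _ _ ([set j | s j == m] `*`
    [set y : {ffun 'I_n -> nat} | (\sum_i s (y i))%N == (k - m)%N]) _ (@ffun_cons n)).
    have fE (z : nat * {ffun 'I_n -> nat}) : \prod_i f i (ffun_cons z i) =
        f ord0 z.1 * \prod_i f (lift ord0 i) (z.2 i).
      rewrite big_ord_recl ffun_cons0; congr (_ * _).
      by apply: eq_bigr => i _; rewrite ffun_consS.
    under eq_esum do rewrite fE.
    apply: (@esum_prod _ _ _ _ _ (f ord0)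
      (fun y : {ffun 'I_n -> nat} => \prod_i f (lift ord0 i) (y i))).
    - by [].
    - by move=> y; rewrite prodr_ge0.
    - exact: fF.
    - exact: (IH (fun i => f (lift ord0 i)) (fun i => F (lift ord0 i))).
  split.
  - move=> [j y] /= [/eqP sj /eqP sy]; rewrite /J /= ffun_cons0; split=> //.
    by rewrite -sy; apply: eq_bigr => i _; rewrite ffun_consS.
  - by move=> z z' _ _; exact: ffun_cons_inj.
  - move=> x [s0 sS]; exists (x ord0, [ffun j => x (lift ord0 j)]); last first.
      by rewrite -ffun_cons_surj.
    split=> /=; first exact/eqP.
    by apply/eqP; rewrite -sS; apply: eq_bigr => i _; rewrite ffunE.
under eq_esum do rewrite JE.
rewrite esum_fset; last 2 first.
- exact: finite_II.
- move=> m _; rewrite -JE esum_ge0 // => x _.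
  by rewrite lee_fin prodr_ge0.
rewrite fsumEFin; last exact: finite_II.
by rewrite -(fsbig_ord _ k.+1 (fun m => F ord0 m * (\prod_i F (lift ord0 i)) (k - m)%N))
  [in RHS]big_ord_recl fpsME.
Qed.

(** * Geometric sums and the laws of W_T and U_T *)

Lemma nneseries_geometric (K : realType) (a z : K) : 0 <= z -> z < 1 ->
  (\sum_(0 <= i <oo) (a * z ^+ i)%:E = (a / (1 - z))%:E)%E.
Proof.
move=> z0 z1; apply: cvg_lim => //; apply: cvg_EFin.
  by apply: nearW => n; rewrite sumEFin.
rewrite [X in X @ _ --> _](_ : _ = series (geometric a z)); last first.
  by apply/funext => n /=; rewrite sumEFin.
by apply: cvg_geometric_series; rewrite ger0_norm.
Qed.

Lemma esum_geom_pos (q : R) : 0 <= q -> q < 1 ->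
  (\esum_(j in [set j | (0 < j)%N]) (q ^+ j * (1 - q))%:E = q%:E)%E.
Proof.
move=> q0 q1.
rewrite (@reindex_esum _ _ _ [set: nat] _ succn); last first.
  split=> [j _ //|i j _ _ []//|[//|j] _]; by exists j.
rewrite -nneseries_esumT; last first.
  by move=> n; rewrite lee_fin mulr_ge0 ?exprn_ge0 // subr_ge0 ltW.
rewrite (eq_eseriesr (g := fun i => ((q * (1 - q)) * q ^+ i)%:E)); last first.
  by move=> i _; rewrite exprS; congr EFin; ring.
by rewrite nneseries_geometric // mulfK // subr_eq0 eq_sym lt_eqF.
Qed.

Lemma kub_pmf_ge0 p k : (1 < p)%N -> 0 <= kub_pmf p k.
Proof.
move=> p1; rewrite /kub_pmf mulr_ge0 ?exprn_ge0 ?invr_ge0 // subr_ge0.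
by rewrite invf_le1 ?ler1n ?ltr0n // ltnW.
Qed.

Lemma prod_prm (T : seq nat) (F : nat -> fps) :
  \prod_(i < size T) F (prm T i) = \prod_(p <- T) F p.
Proof. by rewrite (big_nth 0%N) big_mkord. Qed.

Lemma KProb_W T k : all prime T ->
  KProb [set x : sample T | W_T x == k] = (\prod_(p <- T) fps_geom p%:R^-1) k.
Proof.
move=> /allP Tp; rewrite -prod_prm /KProb /joint_pmf /W_T.
have p1 i : (1 < prm T i)%N by rewrite prime_gt1 // Tp // mem_nth.
rewrite (esum_level_prod (s := id) (f := fun i => kub_pmf (prm T i))
  (F := fun i => fps_geom (prm T i)%:R^-1)) //.
  by move=> i j; exact: kub_pmf_ge0.
move=> i m; rewrite (_ : [set j | j == m] = [set m]).
  by rewrite esum_set1 // lee_fin kub_pmf_ge0.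
by apply/seteqP; split=> j /= /eqP.
Qed.

Lemma KProb_U T k : all prime T ->
  KProb [set x : sample T | U_T x == k] =
  (\prod_(p <- T) (1 + fpsC p%:R^-1 * fpsW)) k.
Proof.
move=> /allP Tp; rewrite -(prod_prm T (fun p => 1 + fpsC p%:R^-1 * fpsW)) /KProb /joint_pmf.
have p1 i : (1 < prm T i)%N by rewrite prime_gt1 // Tp // mem_nth.
have UE (x : sample T) : U_T x = (\sum_i (0 < x i)%N)%N.
  rewrite /U_T -sum1_card big_mkcond; apply: eq_bigr => i _.
  have -> : (i \in [set i | (0 < x i)%N]) = (0 < x i)%N.
    by apply/idP/idP => [/set_mem|h]; [|exact/mem_set].
  by case: (0 < x i)%N.
under eq_set do rewrite UE.
rewrite (esum_level_prod (s := fun j => (0 < j)%N) (f := fun i => kub_pmf (prm T i))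
  (F := fun i => 1 + fpsC (prm T i)%:R^-1 * fpsW)) //.
  by move=> i j; exact: kub_pmf_ge0.
move=> i m; have pm j := kub_pmf_ge0 j (p1 i).
rewrite fpsDE fps1E fpsCM /fpsW fpsDE fpsNE fps1E /fpsX.
(* The indicator of X_p >= 1 has generating function (1 - 1/p) + z/p = 1 + w/p, with no coefficient
   beyond the first. *)
case: m => [|[|m]] /=.
- rewrite (_ : [set j | _] = [set 0%N]).
    by rewrite esum_set1 ?lee_fin // /kub_pmf expr0; congr EFin; ring.
  by apply/seteqP; split=> -[].
- rewrite (_ : [set j | _] = [set j | (0 < j)%N]); last first.
    by apply/seteqP; split=> -[].
  rewrite subr0 mulr1 add0r esum_geom_pos ?invr_ge0 //.
  by rewrite invf_lt1 ?ltr1n ?ltr0n // ltnW.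
- rewrite (_ : [set j | _] = set0); last by apply/seteqP; split=> -[].
  by rewrite esum_set0 subrr mulr0 addr0.
Qed.

(** * The approximation theorem *)

(** Telescoping: 1/(x+1)^2 <= 1/(x(x+1)) = 1/x - 1/(x+1). *)
Lemma sum_inv_sq_le N : \sum_(n < N) (n.+2%:R ^+ 2)^-1 <= 1 - N.+1%:R^-1 :> R.
Proof.
elim: N => [|N IH]; first by rewrite big_ord0 invr1 subrr.
rewrite big_ord_recr /=; apply: le_trans (lerD IH (lexx _)) _.
have x0 : 0 < N.+1%:R :> R by rewrite ltr0n.
rewrite -(natr1 N.+1); set x := N.+1%:R in x0 *.
have -> : 1 - (x + 1)^-1 = 1 - x^-1 + (x * (x + 1))^-1.
  by field; apply/andP; split; apply/eqP; lra.
rewrite lerD2l lef_pV2 ?posrE; nra.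
Qed.

(** Distinct primes embed the sum into the one over all integers from 2 on. The bound makes the
    exponential factor of [prod_factor] absolute. *)
Lemma H''_T_le1 T : uniq T -> all prime T -> H''_T T <= 1.
Proof.
move=> uT /allP Tp; rewrite /H''_T.
pose N := \max_(p <- T) p.
have lt_N p : p \in T -> (2 <= p < 2 + N)%N.
  move=> pT; rewrite prime_gt1 ?Tp //= add2n ltnS leqW //.
  by rewrite /N (big_rem p) //= leq_maxl.
have pT : perm_eq T [seq n <- iota 2 N | n \in T].
  apply: uniq_perm => //; first by rewrite filter_uniq // iota_uniq.
  move=> p; rewrite mem_filter mem_iota; case pT: (p \in T) => //=.
  by rewrite lt_N.
rewrite (perm_big _ pT) /= big_filter big_mkcond /=.
apply: (@le_trans _ _ (1 - N.+1%:R^-1)); last by rewrite gerBl.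
apply: le_trans (sum_inv_sq_le N).
rewrite -(big_mkord predT (fun n => (n.+2%:R ^+ 2)^-1)) -[iota 2 N]/(iota (2 + 0) N).
rewrite iotaDl big_map /index_iota subn0; apply: ler_sum => n _.
by case: ifP => _ //; rewrite invr_ge0 exprn_ge0.
Qed.

Lemma H''_T_ge0 T : 0 <= H''_T T.
Proof. by rewrite /H''_T sumr_ge0 // => p _; rewrite invr_ge0 exprn_ge0. Qed.

Definition kub_const (c : R) : R :=
  near_mode_const * (c * expR ((1 + 39 / 20) ^+ 2 * c)).

(** Common to both choices of Y: only the factorization of each generating function and an O(1/p^2)
    bound on its correction enter. *)
Lemma kub_approx (T : seq nat) (F h : nat -> fps) (a : nat -> R) (c : R) k :
    uniq T -> all prime T -> 0 <= c -> (forall p, p \in T -> 0 <= a p) ->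
    (forall p, p \in T -> F p = fps_pois (a p) * (1 + fpsW * (fpsW * h p))) ->
    (forall p, p \in T -> wbound (39 / 20) (h p) (c * (p%:R ^+ 2)^-1)) ->
  `|(\prod_(p <- T) F p) k - pois_pmf (\sum_(p <- T) a p) k| <=
    kub_bound (kub_const c) (H''_T T) (\sum_(p <- T) a p) k.
Proof.
move=> uT Tp c0 a0 FE hb.
have r0 : 0 <= 39 / 20 :> R by lra.
have [Q -> Qb] := prod_factor r0 FE hb.
rewrite -mulr_sumr -/(H''_T T) in Qb.
have h1 := H''_T_le1 uT Tp; have h0 := H''_T_ge0 T.
set H := \sum_(p <- T) a p; set H2 := H''_T T in Qb h0 h1 *.
have H0 : 0 <= H by rewrite /H big_seq sumr_ge0.
pose M := c * expR ((1 + 39 / 20) ^+ 2 * c) * H2.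
have {}Qb : wbound (39 / 20) Q M.
  apply: wbound_le Qb; rewrite /M [leRHS]mulrAC ler_wpM2l ?mulr_ge0 //.
  by rewrite ler_expR mulrA ler_piMr // mulr_ge0 ?exprn_ge0 // addr_ge0.
have -> : (fps_pois H * (1 + fpsW * (fpsW * Q))) k - pois_pmf H k =
    (fps_pois H * (fpsW * (fpsW * Q))) k.
  by rewrite mulrDr mulr1 fpsDE addrAC subrr add0r.
rewrite /kub_bound; case: ifP => kH.
  apply: le_trans (near_mode_bound H0 Qb kH) _.
  by rewrite /kub_const /M -!mulrA.
(* The same constant serves the tail because 9 <= [near_mode_const]. *)
apply: le_trans (tail_bound k H0 Qb) _.
rewrite ler_wpM2r ?invr_ge0 ?exprn_ge0 //.
rewrite ler_wpM2r ?expR_ge0 // /kub_const -mulrA -/M.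
by rewrite ler_wpM2r ?near_mode_const_ge9 // (wbound_ge0 Qb).
Qed.

Theorem theorem4 : exists C : R,
  forall (T : seq nat), uniq T -> all prime T -> forall k : nat,
    `| KProb [set x : sample T | U_T x == k] - pois_pmf (H_T T) k |
        <= kub_bound C (H''_T T) (H_T T) k
    /\
    `| KProb [set x : sample T | W_T x == k] - pois_pmf (H'_T T) k |
        <= kub_bound C (H''_T T) (H'_T T) k.
Proof.
have r0 : 0 <= 39 / 20 :> R by lra.
pose K0 : R := 2 * expR 1 ^+ 2 * expR (39 / 20).
have K00 : 0 <= K0 by rewrite /K0 !mulr_ge0 // ?exprn_ge0 ?expR_ge0.
(* The first summand is the constant of [wbound_bernoulli_factor]; the second, 160 = 40 * 4, serves
   the geometric factors below. *)
pose c : R := ((2 + 39 / 20) * K0 + 1) + 160 * K0.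
have c0 : 0 <= c by rewrite /c; lra.
exists (kub_const c) => T uT Tp k.
have T2 p : p \in T -> 2 <= p%:R :> R.
  by move=> pT; rewrite ler_nat prime_gt1 // (allP Tp).
have sqV (p : nat) : (p%:R ^+ 2)^-1 = (p%:R^-1) ^+ 2 :> R by rewrite exprVn.
split.
- rewrite KProb_U // /H_T.
  apply: (@kub_approx T _ (fun p => (1 + fpsC p%:R^-1 * fpsW) * fps_phi p%:R^-1 -
    fpsC p%:R^-1 * fpsC p%:R^-1) (fun p => p%:R^-1)) => //.
  + by move=> p _; exact: bernoulli_factor.
  + move=> p pT; have p2 := T2 p pT.
    apply: wbound_le (wbound_bernoulli_factor r0 _ _); last 2 first.
    * by rewrite invr_ge0.
    * by rewrite invf_le1; lra.
    rewrite sqV ler_wpM2r ?exprn_ge0 ?invr_ge0 // -/K0 /c; lra.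
- rewrite KProb_W // /H'_T.
  have aE p : p \in T -> (p%:R - 1)^-1 = p%:R^-1 / (1 - p%:R^-1) :> R.
    move=> /T2; move: (p%:R : R) => x x2.
    by field; apply/andP; split; apply/eqP; lra.
  apply: (@kub_approx T _ (fun p => fps_geom p%:R^-1 * fps_phi (p%:R - 1)^-1)
    (fun p => (p%:R - 1)^-1)) => //.
  + by move=> p /T2 p2; rewrite invr_ge0; lra.
  + move=> p pT; rewrite aE //; apply: geometric_factor.
    have p2 := T2 p pT; have : p%:R^-1 < 1 :> R by rewrite invf_lt1; lra.
    by move=> h; apply/eqP; lra.
  + move=> p pT; have p2 := T2 p pT.
    set a := (p%:R - 1)^-1; set q := p%:R^-1.
    have q0 : 0 <= q by rewrite invr_ge0.
    have q2 : q <= 1 / 2 by rewrite div1r lef_pV2 ?posrE; lra.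
    have a0 : 0 <= a by rewrite invr_ge0; lra.
    have a1 : a <= 1 by rewrite invf_le1; lra.
    have aq : a <= 2 * q.
      by rewrite /a /q -ler_pdivrMl // -invfM lef_pV2 ?posrE; lra.
    apply: wbound_le (wboundM r0 (wbound_geom r0 q0 _ _) (wbound_phi r0 a0 a1));
      [|lra|lra].
    (* The worst case is p = 2, where 1 - 1.95/2 = 1/40; a radius below 2 is essential here. *)
    have g40 : (1 - 39 / 20 * q)^-1 <= 40.
      by rewrite -[40]invrK lef_pV2 ?posrE ?invr_gt0; lra.
    rewrite sqV -/q -/K0.
    apply: (@le_trans _ _ (40 * (K0 * (4 * q ^+ 2)))).
      apply: ler_pM => //.
      - by rewrite invr_ge0; lra.
      - by rewrite mulr_ge0 // exprn_ge0.
      - by rewrite ler_wpM2l //; nra.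
    have := sqr_ge0 q; rewrite /c; nra.
Qed.
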